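(* Let $n\in\mathbb{N}$ and $f\in C_B(\mathbb{R})\cup C_U(\mathbb{R})$. Then $$\omega(\overline{A_n}(f),\theta)\le\omega(f,\theta)\qquad\text{for every }\theta>0.$$ Furthermore, if $f\in C_U(\mathbb{R})$, then $\overline{A_n}(f)\in C_U(\mathbb{R})$.
   Context: Fix real parameters $q>0$, $\beta>0$, $B>1$; $\mathbb{N}=\{1,2,3,\dots\}$. For $x\in\mathbb{R}$ and any $p>0$ put $$\nu_{p,\beta}(x)=\frac{1}{1+pB^{-\beta x}},\qquad G_{p,\beta}(x)=\tfrac12\big(\nu_{p,\beta}(x+1)-\nu_{p,\beta}(x-1)\big),\qquad \Psi(x)=\tfrac12\big(G_{q,\beta}(x)+G_{1/q,\beta}(x)\big).$$ $C_B(\mathbb{R})$ is the set of continuous bounded functions $f:\mathbb{R}\to\mathbb{R}$; $C_U(\mathbb{R})$ is the set of all uniformly continuous (not necessarily bounded) functions $f:\mathbb{R}\to\mathbb{R}$. The modulus of continuity is $\omega(f,\theta)=\sup\{|f(x)-f(y)|: x,y\in\mathbb{R},\ |x-y|\le\theta\}$ for $\theta>0$. Fix $r\in\mathbb{N}$ and weights $w_1,\dots,w_r\ge0$ with $\sum_{j=1}^r w_j=1$. For $n\in\mathbb{N}$ the quadrature type operator $\overline{A_n}$ is given (for unbounded $f$ by the same formula) by $$\overline{A_n}(f)(x)=\int_{-\infty}^{\infty}\left(\sum_{j=1}^r w_j\, f\!\left(\frac vn+\frac{j}{nr}\right)\right)\Psi(nx-v)\,dv .$$ *)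

(* Defs.v *)
From HB Require Import structures.
From mathcomp Require Import all_boot all_order all_algebra.
From mathcomp Require Import all_classical all_reals all_analysis.

Set Implicit Arguments.
Unset Strict Implicit.
Unset Printing Implicit Defensive.

Import Order.TTheory GRing.Theory Num.Theory.
Import numFieldNormedType.Exports.

Local Open Scope classical_set_scope.
Local Open Scope ring_scope.

Definition nu {R : realType} (B beta p x : R) : R :=
  1 / (1 + p * B `^ (- (beta * x))).

Definition G {R : realType} (B beta p x : R) : R :=
  1 / 2 * (nu B beta p (x + 1) - nu B beta p (x - 1)).

Definition Psi {R : realType} (B beta q x : R) : R :=
  1 / 2 * (G B beta q x + G B beta (1 / q) x).

Definition C_B {R : realType} : set (R -> R) :=
  [set f | continuous f /\ bounded_fun f].

Definition C_U {R : realType} : set (R -> R) :=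
  [set f | unif_continuous f].

(* Extended-real supremum: for general f the modulus may be +oo. *)
Definition omega {R : realType} (f : R -> R) (theta : R) : \bar R :=
  ereal_sup [set z | exists x y : R,
    `|x - y| <= theta /\ z = `|f x - f y|%:E].

(* Lebesgue integral over the whole line; Rintegral is real-valued, and is
   the genuine integral whenever the integrand is integrable, as it is for f
   in C_B or C_U: such f grows at most linearly and Psi decays
   exponentially. Only w 1, ..., w r are used. *)
Definition Abar {R : realType} (B beta q : R) (r : nat) (w : nat -> R)
    (n : nat) (f : R -> R) (x : R) : R :=
  \int[lebesgue_measure]_(v in [set: R])
    ((\sum_(1 <= j < r.+1) w j * f (v / n%:R + j%:R / (n%:R * r%:R)))
     * Psi B beta q (n%:R * x - v)).

(* Main.v *)
(** Substituting [v = n x - u] moves the argument [x] from the kernel to [f], so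
    [Abar f x - Abar f y] is the integral against [Psi u] of averages of
    differences of values of [f] at points that are exactly [x - y] apart. As
    [Psi] is nonnegative with integral at most 1, every bound on those
    differences passes to [Abar f]. The mass bound comes from a primitive of
    [Psi] with values in [[0, 1]]: [nu] is the derivative of
    [ln (B^(beta x) + p) / (beta ln B)], so [Psi] is the derivative of an average
    of difference quotients of this function, which increases with slope at
    most 1. Integrability holds because [f] grows at most linearly while
    [Psi x] is dominated by a multiple of [1 / ((1 + |x|) (1 + x^2))]. *)
Require Import Defs.
From mathcomp Require Import all_boot all_order all_algebra.
From mathcomp Require Import all_classical all_reals all_analysis.
From mathcomp Require Import measurable_realfun ring lra.

Set Implicit Arguments.
Unset Strict Implicit.
Unset Printing Implicit Defensive.

Import Order.TTheory GRing.Theory Num.Theory.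
Import numFieldNormedType.Exports.

Local Open Scope classical_set_scope.
Local Open Scope ring_scope.

(** * Reflections of the line and integrals of nonnegative functions with a bounded primitive *)

Lemma lebesgue_measure_reflection (R : realType) (a : R) (A : set R) :
  measurable A ->
  pushforward (@lebesgue_measure R)
    ((fun u => a - u) : measurableTypeR R -> measurableTypeR R) A =
  lebesgue_measure A.
Proof.
have ma : measurable_fun setT ((fun u => a - u) : measurableTypeR R -> _).
  exact: measurable_funB.
(* By uniqueness of Lebesgue measure, half-open intervals suffice; the reflection moves the open end
   to the other side but keeps the length. *)
move=> mA; apply/esym/lebesgue_measure_unique => //= _ [[b c]] _ <-.
rewrite /pushforward/=.
rewrite (_ : _ @^-1` _ = `[a - c, a - b[%classic); last first.
  by apply/seteqP; split => u /=; rewrite !in_itv/=; lra.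
rewrite !lebesgue_measure_itv/= !lte_fin ltrD2l ltrN2.
by case: ifP => // _; rewrite -!EFinD; congr EFin; ring.
Qed.

Lemma Rintegral_reflection (R : realType) (a : R) (h : R -> R) :
  measurable_fun setT h ->
  (@lebesgue_measure R).-integrable setT (EFin \o (fun u => h (a - u))) ->
  \int[lebesgue_measure]_v h v = \int[lebesgue_measure]_u h (a - u).
Proof.
move=> mh ih; have ma : measurable_fun setT
  ((fun u => a - u) : measurableTypeR R -> measurableTypeR R).
  exact: measurable_funB.
rewrite /Rintegral; congr fine.
transitivity (\int[pushforward (@lebesgue_measure R)
    ((fun u => a - u)%R : measurableTypeR R -> measurableTypeR R)]_v (h v)%:E)%E.
  by apply: eq_measure_integral => //= A mA _; rewrite lebesgue_measure_reflection.
by rewrite integral_pushforward//; exact/measurable_EFinP.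
Qed.

Lemma ge0_integral_bounded_primitive (R : realType) (h H : R -> R) (m M : R) :
  continuous h -> (forall x, 0 <= h x) ->
  (forall x : R, is_derive x 1 H (h x)) -> (forall x, m <= H x <= M) ->
  (\int[lebesgue_measure]_x (h x)%:E <= (M - m)%:E)%E.
Proof.
move=> ch h0 dH bH.
(* Every truncated integral is a difference of two values of [H]. *)
pose F (k : nat) : set R := `[- k%:R, k%:R]%classic.
have mh A : measurable A -> measurable_fun A (EFin \o h).
  move=> mA; apply/measurable_EFinP; apply: measurable_funTS.
  exact: continuous_measurable_fun.
have FT : \bigcup_k F k = setT by exact: bigcup_itvT.
have cv : (\int[lebesgue_measure]_(x in F k) (h x)%:E)%E @[k --> \oo] -->
    (\int[lebesgue_measure]_x (h x)%:E)%E.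
  rewrite -FT; apply: ge0_nondecreasing_set_cvg_integral.
  - move=> k l kl; apply/subsetPset => x /=; rewrite /F/= !in_itv/=.
    have : (k%:R : R) <= l%:R by rewrite ler_nat.
    lra.
  - by move=> k; exact: measurable_itv.
  - by move=> k; apply: mh; exact: measurable_itv.
  - by move=> k x _; rewrite lee_fin.
apply: (cvge_to_le cv); apply: nearW => k.
(* For [k = 0] the interval is a point, and the fundamental theorem needs distinct endpoints. *)
have [->|k0] := eqVneq k 0%N.
  rewrite /F oppr0 set_itv1 integral_set1 lee_fin subr_ge0.
  by case/andP: (bH 0); exact: le_trans.
have cH x : {for x, continuous H}.
  by apply: differentiable_continuous; apply/derivable1_diffP; exact: ex_derive.
rewrite (@continuous_FTC2 _ _ H).
- by rewrite -EFinB lee_fin lerB//; [case/andP: (bH k%:R)|case/andP: (bH (- k%:R))].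
- have : (0 : R) < k%:R by rewrite ltr0n lt0n.
  lra.
- by apply: continuous_subspaceT.
- split.
  + by move=> x _; exact: ex_derive.
  + by apply: cvg_at_right_filter; exact: cH.
  + by apply: cvg_at_left_filter; exact: cH.
- by move=> x _; rewrite derive1E; exact: derive_val.
Qed.

Lemma integrable_bounded_primitive (R : realType) (h H : R -> R) (m M : R) :
  continuous h -> (forall x, 0 <= h x) ->
  (forall x : R, is_derive x 1 H (h x)) -> (forall x, m <= H x <= M) ->
  (@lebesgue_measure R).-integrable setT (EFin \o h).
Proof.
move=> ch h0 dH bH; apply/integrableP; split.
  by apply/measurable_EFinP; exact: continuous_measurable_fun.
under eq_integral do rewrite /= ger0_norm//.
apply: (@le_lt_trans _ _ (M - m)%:E); last exact: ltry.
exact: ge0_integral_bounded_primitive dH bH.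
Qed.

(** The majorant for all dominated integrands below; its primitive [atan] is bounded by [pi / 2] in
    absolute value. *)
Lemma integrable_oneDsqrV (R : realType) :
  (@lebesgue_measure R).-integrable setT (fun x => ((1 + x ^+ 2)^-1)%:E).
Proof.
apply: (@integrable_bounded_primitive _ (fun x => (1 + x ^+ 2)^-1) atan
  (- (pi / 2)) (pi / 2)).
- exact: continuous_oneDsqrV.
- by move=> x; rewrite invr_ge0 addr_ge0// sqr_ge0.
- by move=> x; rewrite ltW ?atan_gtNpi2// ltW// atan_ltpi2.
Qed.

(** * Monotonicity and continuity of [nu], and the sign and continuity of [Psi] *)

Lemma nuE (R : realType) (B beta p x : R) : 1 < B ->
  nu B beta p x = (1 + p * expR (- (beta * ln B * x)))^-1.
Proof.
move=> B1; rewrite /nu div1r /powR gt_eqF ?(lt_trans ltr01)//.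
by congr (1 + p * expR _)^-1; ring.
Qed.

Lemma nu_le (R : realType) (B beta p x y : R) : 0 < p -> 0 < beta -> 1 < B ->
  x <= y -> nu B beta p x <= nu B beta p y.
Proof.
move=> p0 b0 B1 xy; have l0 : 0 < beta * ln B by rewrite mulr_gt0// ln_gt0.
have q0 z : 0 < 1 + p * expR (- (beta * ln B * z)).
  by rewrite addr_gt0// mulr_gt0// expR_gt0.
rewrite !nuE// lef_pV2 ?posrE// lerD2l ler_pM2l// ler_expR lerN2.
by rewrite ler_pM2l.
Qed.

Lemma continuous_nu (R : realType) (B beta p : R) : 0 < p -> 1 < B ->
  continuous (nu B beta p).
Proof.
move=> p0 B1 x.
rewrite (_ : nu B beta p = fun y => (1 + p * expR (- (beta * ln B * y)))^-1);
  last by apply/funext => y; exact: nuE.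
apply: cvgV; first by rewrite gt_eqF// addr_gt0// mulr_gt0// expR_gt0.
apply: cvgD; first exact: cvg_cst.
apply: cvgM; first exact: cvg_cst.
apply: (@continuous_comp _ _ _ (fun y : R => - (beta * ln B * y)) expR);
  last exact: continuous_expR.
by apply: cvgN; apply: cvgM; [exact: cvg_cst|exact: cvg_id].
Qed.

Lemma continuous_Psi (R : realType) (B beta q : R) : 0 < q -> 1 < B ->
  continuous (Psi B beta q).
Proof.
move=> q0 B1.
have cG p : 0 < p -> continuous (G B beta p).
  move=> p0 x; apply: cvgM; first exact: cvg_cst.
  apply: cvgB.
  - apply: (@continuous_comp _ _ _ (fun y : R => y + 1) (nu B beta p)).
      by apply: cvgD; [exact: cvg_id|exact: cvg_cst].
    exact: continuous_nu.
  - apply: (@continuous_comp _ _ _ (fun y : R => y - 1) (nu B beta p)).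
      by apply: cvgB; [exact: cvg_id|exact: cvg_cst].
    exact: continuous_nu.
move=> x; apply: cvgM; first exact: cvg_cst.
by apply: cvgD; apply: cG; rewrite ?divr_gt0.
Qed.

Lemma Psi_ge0 (R : realType) (B beta q x : R) : 0 < q -> 0 < beta -> 1 < B ->
  0 <= Psi B beta q x.
Proof.
move=> q0 b0 B1.
have G0 p : 0 < p -> 0 <= G B beta p x.
  by move=> p0; rewrite mulr_ge0 ?divr_ge0// subr_ge0 nu_le//; lra.
by rewrite mulr_ge0 ?divr_ge0// addr_ge0 ?G0 ?divr_gt0.
Qed.

(** * A primitive of [Psi] with values in [[0, 1]] *)

Lemma is_derive_nu_primitive (R : realType) (B beta p x : R) :
  0 < p -> 0 < beta -> 1 < B ->
  is_derive x 1
    (fun y => (beta * ln B)^-1 * ln (expR (beta * ln B * y) + p))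
    (nu B beta p x).
Proof.
move=> p0 b0 B1; have l0 : 0 < beta * ln B by rewrite mulr_gt0// ln_gt0.
rewrite nuE//; set l := beta * ln B in l0 *.
have e0 : 0 < expR (l * x) + p by rewrite addr_gt0// expR_gt0.
have d1 : is_derive x 1 (fun y => expR (l * y)) (expR (l * x) * l).
  apply: (@is_derive1_comp _ expR (fun y => l * y)).
  by apply: is_derive_eq; rewrite -/(l *: (1 : R)) /GRing.scale/= mulr1.
have d2 : is_derive x 1 (fun y => expR (l * y) + p) (expR (l * x) * l).
  by apply: is_derive_eq; rewrite addr0.
have d3 : is_derive x 1 (fun y => ln (expR (l * y) + p))
    ((expR (l * x) + p)^-1 * (expR (l * x) * l)).
  apply: (@is_derive1_comp _ (@ln R) (fun y => expR (l * y) + p)).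
  exact: is_derive1_ln.
(* The chain rule gives [e^(l x) / (e^(l x) + p)]; dividing through by [e^(l x)] yields the logistic
   form. *)
apply: is_derive_eq.
rewrite expRN /GRing.scale/=.
by field; rewrite !gt_eqF ?expR_gt0//= addr_gt0// expR_gt0.
Qed.

(** The upper bound is [e^(l (x + 1)) + p <= e^(2 l) (e^(l (x - 1)) + p)], true because
    [p <= p e^(2 l)]. Divided by [2 l], it says that the difference quotient over [[x - 1, x + 1]]
    is at most 1. *)
Lemma nu_primitive_increment (R : realType) (l p x : R) : 0 < l -> 0 < p ->
  0 <= ln (expR (l * (x + 1)) + p) - ln (expR (l * (x - 1)) + p) <= l *+ 2.
Proof.
move=> l0 p0; have e0 y : 0 < expR y + p by rewrite addr_gt0// expR_gt0.
rewrite subr_ge0 lerBlDl ler_ln ?posrE// lerD2r ler_expR ler_pM2l//.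
apply/andP; split; first lra.
rewrite -[l *+ 2]expRK -lnM ?posrE ?expR_gt0// ler_ln ?posrE ?mulr_gt0 ?expR_gt0//.
rewrite mulrDl -expRD (_ : l * (x - 1) + l *+ 2 = l * (x + 1)); last by ring.
rewrite lerD2l ler_peMr ?(ltW p0)// -[leLHS]expR0 ler_expR mulrn_wge0//.
exact: ltW.
Qed.

Lemma Psi_primitive (R : realType) (B beta q : R) :
  0 < q -> 0 < beta -> 1 < B ->
  exists2 H : R -> R, forall x : R, is_derive x 1 H (Psi B beta q x)
    & forall x, 0 <= H x <= 1.
Proof.
move=> q0 b0 B1; have l0 : 0 < beta * ln B by rewrite mulr_gt0// ln_gt0.
have PG p : 0 < p -> exists2 H : R -> R,
    forall x : R, is_derive x 1 H (G B beta p x) & forall x, 0 <= H x <= 1.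
  move=> p0.
  pose N y := (beta * ln B)^-1 * ln (expR (beta * ln B * y) + p).
  exists (fun x => 1 / 2 * (N (x + 1) - N (x - 1))) => x.
    have dN c : is_derive x 1 (fun y : R => N (y + c)) (nu B beta p (x + c)).
      rewrite -[nu _ _ _ _]mulr1.
      apply: (@is_derive1_comp _ N (fun y => y + c)).
        exact: is_derive_nu_primitive.
      by apply: is_derive_eq; rewrite addr0.
    have d1 := dN 1; have d2 := dN (- 1).
    by apply: is_derive_eq; rewrite /GRing.scale.
  have := nu_primitive_increment x l0 p0.
  rewrite -(ler_pM2l (_ : 0 < (beta * ln B)^-1)) ?invr_gt0// mulr0.
  rewrite -[X in _ && X](ler_pM2l (_ : 0 < (beta * ln B)^-1)) ?invr_gt0//.
  rewrite mulrBr -[in X in _ && X]mulr_natr mulrA mulVf ?gt_eqF// -!/(N _).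
  by lra.
have [H1 dH1 b1] := PG _ q0.
have [H2 dH2 b2] : exists2 H : R -> R,
    forall x : R, is_derive x 1 H (G B beta (1 / q) x)
    & forall x, 0 <= H x <= 1 by apply: PG; rewrite divr_gt0.
exists (fun x => 1 / 2 * (H1 x + H2 x)) => x.
  have d1 := dH1 x; have d2 := dH2 x.
  by apply: is_derive_eq; rewrite /GRing.scale.
by have := b1 x; have := b2 x; lra.
Qed.

(** * Decay of the kernel and integrability against it *)

Lemma G_decay (R : realType) (B beta p x : R) : 0 < p -> 0 < beta -> 1 < B ->
  G B beta p x <=
    expR (beta * ln B) * (p + p^-1) * expR (- (beta * ln B * `|x|)).
Proof.
move=> p0 b0 B1; have l0 : 0 < beta * ln B by rewrite mulr_gt0// ln_gt0.
rewrite /G !nuE//; set l := beta * ln B in l0 *.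
have pV0 : 0 < p^-1 by rewrite invr_gt0.
have pe0 (y : R) : 0 < p * expR y by rewrite mulr_gt0// expR_gt0.
have e0 : 0 < expR l * p * expR (- (l * `|x|)) by rewrite !mulr_gt0// expR_gt0.
have e1 : 0 < expR l * p^-1 * expR (- (l * `|x|)) by rewrite !mulr_gt0// expR_gt0.
have inv_ge (t : R) : 0 < t -> 1 - t <= (1 + t)^-1.
  move=> t0; rewrite -[_^-1]mul1r ler_pdivlMr; last lra.
  by have := sqr_ge0 t; rewrite expr2; lra.
have inv_le (t : R) : 0 < t -> (1 + t)^-1 <= t^-1.
  by move=> t0; rewrite lef_pV2 ?posrE; lra.
have inv_01 (t : R) : 0 < t -> 0 < (1 + t)^-1 <= 1.
  by move=> t0; rewrite invr_gt0 invf_le1 ?addr_gt0//; lra.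
set a := p * expR (- (l * (x + 1))); set b := p * expR (- (l * (x - 1))).
have a0 : 0 < a by exact: pe0.
have b0' : 0 < b by exact: pe0.
have := inv_01 _ a0; have := inv_01 _ b0'.
(* For [x >= 0], use [nu (x + 1) <= 1] and [nu (x - 1) >= 1 - b]; for [x < 0], use
   [nu (x + 1) <= a^-1] and [nu (x - 1) >= 0]. The terms [b] and [a^-1] account for [p] and [p^-1]
   in the constant. *)
have [x0|x0] := leP 0 x.
- have : b = expR l * p * expR (- (l * `|x|)).
    rewrite ger0_norm// [RHS]mulrAC -expRD mulrC; congr (_ * expR _); ring.
  have := inv_ge _ b0'; lra.
- have : a^-1 = expR (l * (x + 1)) * p^-1 by rewrite invfM expRN invrK mulrC.
  rewrite (_ : expR (l * (x + 1)) * p^-1 = expR l * p^-1 * expR (- (l * `|x|))).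
    have := inv_le _ a0; lra.
  rewrite ltr0_norm// [RHS]mulrAC -expRD; congr (expR _ * _); ring.
Qed.

Lemma expR_ge_cube (R : realType) (l : R) : 0 < l ->
  exists2 m : R, 0 < m & forall y, 0 <= y -> m * (1 + y) ^+ 3 <= expR (l * y).
Proof.
(* With this choice [m (1 + y) <= 1 + (l / 3) y <= e^(l y / 3)]; cubing gives the claim. *)
move=> l0; pose m := Num.min 1 (l / 3).
have m0 : 0 < m by rewrite lt_min ltr01 divr_gt0.
have [m1 ml] : m <= 1 /\ m <= l / 3 by rewrite !ge_min !lexx orbT.
exists (m ^+ 3) => [|y y0]; first exact: exprn_gt0.
have -> : expR (l * y) = expR (l / 3 * y) ^+ 3.
  by rewrite -expRM_natl; congr expR; field.
rewrite -exprMn lerXn2r ?nnegrE ?expR_ge0 ?mulr_ge0 ?addr_ge0 ?(ltW m0)//.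
apply: le_trans (expR_ge1Dx _).
by have := ler_wpM2r y0 ml; lra.
Qed.

(** The factor [1 + |x|] is reserved for the linear growth of [f]; what remains is still
    integrable. *)
Lemma Psi_decay (R : realType) (B beta q : R) : 0 < q -> 0 < beta -> 1 < B ->
  exists2 K : R, 0 < K
    & forall x, (1 + `|x|) * Psi B beta q x <= K * (1 + x ^+ 2)^-1.
Proof.
move=> q0 b0 B1; have l0 : 0 < beta * ln B by rewrite mulr_gt0// ln_gt0.
have [m m0 cube] := expR_ge_cube l0.
pose C := expR (beta * ln B) * (q + q^-1).
have C0 : 0 < C by rewrite mulr_gt0 ?expR_gt0// addr_gt0// invr_gt0.
exists (C / m) => [|x]; first by rewrite divr_gt0.
have x0 := normr_ge0 x.
have PC : Psi B beta q x <= C / expR (beta * ln B * `|x|).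
  rewrite -expRN.
  (* The constant [p + p^-1] is the same for [q] and [1 / q], so both halves of [Psi] share one
     bound. *)
  have := G_decay x q0 b0 B1.
  have : 0 < 1 / q by rewrite divr_gt0.
  move=> /(G_decay x)/(_ b0 B1).
  rewrite [in X in _ <= X]div1r invrK [q^-1 + q]addrC -!/C /Psi; lra.
have e0 : 0 < expR (beta * ln B * `|x|) by exact: expR_gt0.
have Dx : 0 < 1 + x ^+ 2 by rewrite ltr_pwDl// sqr_ge0.
rewrite ler_pdivlMr//.
(* Here [1 + x^2 <= (1 + |x|)^2], which explains the cube. *)
apply: (@le_trans _ _ ((1 + `|x|) ^+ 3 * (C / expR (beta * ln B * `|x|)))).
  rewrite mulrAC; apply: ler_pM => //.
  - by rewrite mulr_ge0// addr_ge0// sqr_ge0.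
  - exact: Psi_ge0.
  - rewrite -[x ^+ 2]real_normK ?num_real// !exprS expr0.
    have : 0 <= `|x| * `|x| by rewrite mulr_ge0.
    lra.
rewrite mulrA ler_pdivrMr// [leLHS]mulrC -[leRHS]mulrA ler_pM2l// ler_pdivlMl//.
exact: cube.
Qed.

Lemma integrable_mul_Psi (R : realType) (B beta q : R) (g : R -> R) (K : R) :
  0 < q -> 0 < beta -> 1 < B ->
  continuous g -> (forall u, `|g u| <= K * (1 + `|u|)) ->
  (@lebesgue_measure R).-integrable setT (EFin \o (fun u => g u * Psi B beta q u)).
Proof.
move=> q0 b0 B1 cg gK; have [M M0 PM] := Psi_decay q0 b0 B1.
have K0 : 0 <= K.
  by apply: le_trans (normr_ge0 (g 0)) (le_trans (gK 0) _); rewrite normr0 addr0 mulr1.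
apply: (@le_integrable _ (measurableTypeR R) R lebesgue_measure _ measurableT _
  (fun u : R => (K * M)%:E * ((1 + u ^+ 2)^-1)%:E)%E).
- apply/measurable_EFinP; apply: continuous_measurable_fun => u.
  by apply: cvgM; [exact: cg|exact: continuous_Psi].
- move=> u _; rewrite -EFinM /= lee_fin normrM (ger0_norm (Psi_ge0 _ _ _ _))//.
  rewrite [leRHS]ger0_norm; last first.
    by rewrite !mulr_ge0 ?(ltW M0)// invr_ge0 addr_ge0// sqr_ge0.
  apply: (@le_trans _ _ (K * ((1 + `|u|) * Psi B beta q u))).
    by rewrite [leRHS]mulrA ler_wpM2r ?Psi_ge0.
  by rewrite -[leRHS]mulrA ler_wpM2l.
- by apply: integrableZl => //; exact: integrable_oneDsqrV.
Qed.

Lemma Rintegral_Psi_le1 (R : realType) (B beta q : R) :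
  0 < q -> 0 < beta -> 1 < B ->
  \int[lebesgue_measure]_u Psi B beta q u <= 1.
Proof.
move=> q0 b0 B1; have [H dH bH] := Psi_primitive q0 b0 B1.
have P0 x : 0 <= Psi B beta q x by exact: Psi_ge0.
have I1 := ge0_integral_bounded_primitive (continuous_Psi q0 B1) P0 dH bH.
rewrite subr0 in I1; rewrite -lee_fin /Rintegral fineK//.
rewrite ge0_fin_numE; first exact: le_lt_trans I1 (ltry _).
by apply: integral_ge0 => x _; rewrite lee_fin.
Qed.

(** * Continuity and at most linear growth of the admissible functions *)

Lemma C_UP (R : realType) (f : R -> R) : C_U f <->
  forall e : R, 0 < e -> exists2 d : R, 0 < d &
    forall x y, `|x - y| < d -> `|f x - f y| < e.
Proof.
rewrite /C_U/=; split => [/unif_continuousP uf e /uf[d d0 fd]|uf].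
  by exists d => // x y xy; exact: (fd (x, y)).
by apply/unif_continuousP => e /uf[d d0 fd]; exists d => // -[x y]; exact: fd.
Qed.

(* [`|t| <= k * (d / 2)] is reached from 0 in [k] steps, each changing [f] by less than 1. *)
Lemma C_U_linear_growth (R : realType) (f : R -> R) : C_U f ->
  exists K : R, forall t, `|f t| <= K * (1 + `|t|).
Proof.
move=> /C_UP/(_ 1 ltr01)[d d0 fd].
have step (k : nat) t : `|t| <= k%:R * (d / 2) -> `|f t| <= `|f 0| + k%:R.
  elim: k t => [|k IH] t tk.
    by move: tk; rewrite mul0r normr_le0 => /eqP ->; rewrite addr0.
  have k0 : 0 < k.+1%:R :> R by rewrite ltr0n.
  pose s := t * (k%:R / k.+1%:R).
  have ts : t - s = t / k.+1%:R by rewrite /s -natr1; field; rewrite natr1 gt_eqF.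
  have sk : `|s| <= k%:R * (d / 2).
    rewrite /s normrM [X in _ * X]ger0_norm ?divr_ge0// mulrCA ler_wpM2l//.
    by rewrite ler_pdivrMr// mulrC.
  have : `|f t - f s| < 1.
    apply: fd; rewrite ts normrM [`|_^-1|]ger0_norm ?invr_ge0// ltr_pdivrMr//.
    rewrite mulrC; apply: le_lt_trans tk _; rewrite ltr_pM2l//; lra.
  have := IH _ sk; have := ler_normD (f s) (f t - f s).
  by rewrite subrKC -natr1; lra.
(* At most [2 |t| / d + 1] steps are needed, so [|f t| <= |f 0| + 1 + (2 / d) |t|]. *)
exists (`|f 0| + 1 + 2 / d) => t.
have t0 : 0 <= `|t| / (d / 2) by rewrite !divr_ge0// ltW.
have /step : `|t| <= (Num.truncn (`|t| / (d / 2))).+1%:R * (d / 2).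
  by rewrite -ler_pdivrMr ?divr_gt0// ltW// truncnS_gt.
have := t0; rewrite -truncn_le -natr1.
rewrite (_ : `|t| / (d / 2) = 2 / d * `|t|); last by field; rewrite gt_eqF.
have := mulr_ge0 (normr_ge0 (f 0)) (normr_ge0 t).
have : 0 <= 2 / d by rewrite divr_ge0// ltW.
by have := normr_ge0 t; lra.
Qed.

Lemma C_B_C_U_growth (R : realType) (f : R -> R) : (C_B `|` C_U) f ->
  continuous f /\ exists K : R, forall t, `|f t| <= K * (1 + `|t|).
Proof.
case=> [[cf [M [_ fM]]]|uf].
  (* [bounded_fun] supplies a bound for every constant strictly above [M]; [|M| + 1] is such a
     constant and is nonnegative. *)
  split => //; exists (`|M| + 1) => t.
  have := fM (`|M| + 1) _ t I; rewrite /=.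
  have : M < `|M| + 1 by rewrite (le_lt_trans (ler_norm M))// ltrDl.
  move=> -> /(_ isT) ft; apply: le_trans ft _.
  by rewrite ler_peMr// ?addr_ge0// lerDl.
split; last exact: C_U_linear_growth.
move=> x; apply/cvgrPdist_lt => e e0.
have /C_UP/(_ e e0)[d d0 fd] := uf.
near=> y; apply: fd; near: y.
exact: cvgr_dist_lt.
Unshelve. all: by end_near. Qed.

(** * The operator after substitution, and its effect on differences *)

Lemma Abar_reflection (R : realType) (B beta q : R) (r : nat) (w : nat -> R)
    (n : nat) (f : R -> R) (x : R) :
  0 < q -> 0 < beta -> 1 < B -> (1 <= r)%N ->
  (forall j : nat, (1 <= j <= r)%N -> 0 <= w j) ->
  \sum_(1 <= j < r.+1) w j = 1 -> (1 <= n)%N -> (C_B `|` C_U) f ->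
  let g u := (\sum_(1 <= j < r.+1)
    w j * f (x - u / n%:R + j%:R / (n%:R * r%:R))) * Psi B beta q u in
  (@lebesgue_measure R).-integrable setT (EFin \o g) /\
  Abar B beta q r w n f x = \int[lebesgue_measure]_u g u.
Proof.
move=> q0 b0 B1 r1 w0 w1 n1 /C_B_C_U_growth[cf [K fK]] g.
have n0 : 0 < n%:R :> R by rewrite ltr0n.
have n1R : 1 <= n%:R :> R by rewrite ler1n.
have r0 : 0 < r%:R :> R by rewrite ltr0n.
have K0 : 0 <= K.
  by apply: le_trans (normr_ge0 (f 0)) (le_trans (fK 0) _); rewrite normr0 addr0 mulr1.
(* The inner map [h] is a parameter so that [s] covers the integrand both before ([v / n]) and after
   ([x - u / n]) the substitution. *)
pose s (h : R -> R) u := \sum_(1 <= j < r.+1) w j * f (h u + j%:R / (n%:R * r%:R)).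
have cs h : continuous h -> continuous (s h).
  move=> ch; apply: continuous_big => [|j _ u]; first exact: add_continuous.
  apply: cvgM; first exact: cvg_cst.
  apply: (@continuous_comp _ _ _ (fun u => h u + j%:R / (n%:R * r%:R)) f).
    by apply: cvgD; [exact: ch|exact: cvg_cst].
  exact: cf.
have cl : continuous (fun u : R => x - u / n%:R).
  move=> u; apply: cvgB; first exact: cvg_cst.
  by apply: cvgM; [exact: cvg_id|exact: cvg_cst].
have ig : (@lebesgue_measure R).-integrable setT (EFin \o g).
  (* Each shift [j / (n r)] lies in [[0, 1]], so [1 + |x - u / n + j / (n r)| <= 2 + |x| + |u| <= (2
     + |x|) (1 + |u|)]. *)
  apply: (integrable_mul_Psi (K := K * (2 + `|x|)) q0 b0 B1 (cs _ cl)) => u.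
  rewrite /s; apply: le_trans (ler_norm_sum _ _ _) _.
  rewrite -[leRHS]mul1r -[X in _ <= X * _]w1 mulr_suml; apply: ler_sum_nat => j jr.
  have wj := w0 _ jr; rewrite normrM ger0_norm// ler_wpM2l//.
  apply: le_trans (fK _) _; rewrite -[leRHS]mulrA ler_wpM2l//.
  set d := j%:R / _.
  have d01 : 0 <= d <= 1.
    rewrite divr_ge0 ?mulr_ge0 ?ler0n// ler_pdivrMr ?mulr_gt0// mul1r -natrM ler_nat.
    by case/andP: jr => _; rewrite ltnS => /leq_trans; apply; rewrite leq_pmull.
  have un : `|u / n%:R| <= `|u|.
    rewrite normrM [X in _ * X]ger0_norm ?invr_ge0 ?ler0n//.
    by rewrite ler_piMr// invf_le1.
  have := ler_normD (x - u / n%:R) d; have := ler_normB x (u / n%:R).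
  rewrite (ger0_norm (_ : 0 <= d)); last by case/andP: d01.
  have := normr_ge0 x; have := normr_ge0 u.
  have := mulr_ge0 (normr_ge0 x) (normr_ge0 u).
  by lra.
pose h v := s (fun v => v / n%:R) v * Psi B beta q (n%:R * x - v).
have hg : (fun u => h (n%:R * x - u)) = g.
  apply/funext => u; rewrite /h /g /s subKr; congr (_ * _).
  apply: eq_bigr => j _; congr (_ * f (_ + _)).
  by field; rewrite gt_eqF.
have mh : measurable_fun setT h.
  apply: continuous_measurable_fun => v; apply: cvgM.
    by apply: cs => u; apply: cvgM; [exact: cvg_id|exact: cvg_cst].
  apply: (@continuous_comp _ _ _ (fun v : R => n%:R * x - v) (Psi B beta q)).
    by apply: cvgB; [exact: cvg_cst|exact: cvg_id].
  exact: continuous_Psi.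
have -> : Abar B beta q r w n f x = \int[lebesgue_measure]_v h v by [].
rewrite -hg in ig *; split; first exact: ig.
exact: Rintegral_reflection mh ig.
Qed.

(** Leaving the bound [c] arbitrary serves both claims: it becomes the value of [omega f theta] for
    the first and [e / 2] for uniform continuity. *)
Lemma Abar_dist_le (R : realType) (B beta q : R) (r : nat) (w : nat -> R)
    (n : nat) (f : R -> R) (x y c : R) :
  0 < q -> 0 < beta -> 1 < B -> (1 <= r)%N ->
  (forall j : nat, (1 <= j <= r)%N -> 0 <= w j) ->
  \sum_(1 <= j < r.+1) w j = 1 -> (1 <= n)%N -> (C_B `|` C_U) f ->
  (forall s t, `|s - t| <= `|x - y| -> `|f s - f t| <= c) ->
  `|Abar B beta q r w n f x - Abar B beta q r w n f y| <= c.
Proof.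
move=> q0 b0 B1 r1 w0 w1 n1 hf fc.
have c0 : 0 <= c by apply: le_trans (fc x y (lexx _)).
have [ix ->] := Abar_reflection x q0 b0 B1 r1 w0 w1 n1 hf.
have [iy ->] := Abar_reflection y q0 b0 B1 r1 w0 w1 n1 hf.
have iP : (@lebesgue_measure R).-integrable setT (EFin \o Psi B beta q).
  have [H dH bH] := Psi_primitive q0 b0 B1.
  apply: integrable_bounded_primitive dH bH; first exact: continuous_Psi.
  by move=> u; exact: Psi_ge0.
rewrite -RintegralB//.
apply: le_trans (le_normr_Rintegral _ _) _ => //.
  by rewrite /comp; under eq_fun do rewrite EFinB; exact: integrableB.
apply: (@le_trans _ _ (\int[lebesgue_measure]_u (c * Psi B beta q u))).
  apply: le_Rintegral => //.
  - apply: (@integrable_norm _ (measurableTypeR R)); rewrite /comp.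
    by under eq_fun do rewrite EFinB; exact: integrableB.
  - by rewrite /comp; under eq_fun do rewrite EFinM; exact: integrableZl.
  move=> u _; rewrite -mulrBl normrM (ger0_norm (Psi_ge0 _ _ _ _))//.
  rewrite ler_wpM2r ?Psi_ge0// -sumrB; apply: le_trans (ler_norm_sum _ _ _) _.
  (* As the weights sum to 1, [c] is split as the sum of the [w j * c] and compared termwise. *)
  rewrite -[leRHS]mul1r -[X in _ <= X * _]w1 mulr_suml; apply: ler_sum_nat => j jr.
  rewrite -mulrBr normrM ger0_norm ?w0// ler_wpM2l ?w0//.
  by apply: fc; rewrite (_ : _ - _ = x - y)//; ring.
rewrite RintegralZl//; have := Rintegral_Psi_le1 q0 b0 B1.
by move=> /(ler_wpM2l c0); rewrite mulr1.
Qed.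

Theorem theorem7 (R : realType) (q beta B : R)
  (hq : 0 < q) (hbeta : 0 < beta) (hB : 1 < B)
  (r : nat) (hr : (1 <= r)%N)
  (w : nat -> R)
  (hw : forall j : nat, (1 <= j <= r)%N -> 0 <= w j)
  (hw1 : \sum_(1 <= j < r.+1) w j = 1)
  (n : nat) (hn : (1 <= n)%N)
  (f : R -> R) (hf : (C_B `|` C_U) f) :
  (forall theta : R, 0 < theta ->
     (omega (Abar B beta q r w n f) theta <= omega f theta)%E) /\
  (C_U f -> C_U (Abar B beta q r w n f)).
Proof.
have dist_le := Abar_dist_le hq hbeta hB hr hw hw1 hn hf.
split=> [theta _|/C_UP uf].
  apply: ge_ereal_sup => _ [x [y [xy ->]]].
  (* An infinite modulus makes the bound trivial. Otherwise it is a real number, nonnegative because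
     it dominates [|f x - f y|], and can serve as [c]. *)
  have [omoo|omlt] := eqVneq (omega f theta) +oo%E; first by rewrite omoo leey.
  have om_ge s t : `|s - t| <= `|x - y| -> (`|f s - f t|%:E <= omega f theta)%E.
    by move=> st; apply: ereal_sup_ubound; exists s, t; rewrite (le_trans st).
  have omfin : omega f theta \is a fin_num.
    rewrite ge0_fin_numE ?ltey//.
    by apply: le_trans (om_ge x y (lexx _)); rewrite lee_fin.
  rewrite -(fineK omfin) lee_fin; apply: dist_le => s t /om_ge.
  by rewrite -{1}(fineK omfin) lee_fin.
apply/C_UP => e e0; have e20 : 0 < e / 2 by rewrite divr_gt0.
have [d d0 fd] := uf _ e20.
(* Halving [e] recovers the strict inequality from a non-strict bound. *)
exists d => // x y xy; apply: (@le_lt_trans _ _ (e / 2)); last lra.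
by apply: dist_le => s t st; apply/ltW/fd/(le_lt_trans st).
Qed.
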